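(* The function $$r\mapsto Q_{2}(r)=\frac{\mathcal{K}(r)}{\ln\left(1+4/r'\right)}$$ is strictly increasing from $(0,1)$ onto $(\pi/\ln 25,\,1)$. Consequently, the double inequality $$\frac{\pi}{2\ln 5}\ln\left(1+\frac{4}{r'}\right)<\mathcal{K}(r)<\ln\left(1+\frac{4}{r'}\right)$$ holds for all $r\in(0,1)$, and the constants $\pi/\ln 25=\pi/(2\ln 5)$ and $1$ multiplying $\ln(1+4/r')$ on the left and on the right are best possible (the first cannot be replaced by a larger constant, and the second cannot be replaced by a smaller constant).
   Context: For $r\in(0,1)$, $\mathcal{K}(r)=\int_{0}^{\pi/2}\frac{dt}{\sqrt{1-r^{2}\sin^{2}t}}$ is Legendre's complete elliptic integral of the first kind, and $r'=\sqrt{1-r^{2}}$. *)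

(* Defs.v *)
From Stdlib Require Import Reals Lra.
From Coquelicot Require Import Coquelicot.

Open Scope R_scope.

(* The modulus r ranges over (0, 1); [RInt] is total, and [ex_RInt_ellipticK]
   below shows that the integral exists on the whole range of moduli. *)
Definition ellipticK (r : R) : R :=
  RInt (fun t : R => / sqrt (1 - r ^ 2 * sin t ^ 2)) 0 (PI / 2).

Definition comodulus (r : R) : R := sqrt (1 - r ^ 2).

Definition Q2 (r : R) : R := ellipticK r / ln (1 + 4 / comodulus r).

Lemma ex_RInt_ellipticK (r : R) : 0 < r < 1 ->
  ex_RInt (fun t : R => / sqrt (1 - r ^ 2 * sin t ^ 2)) 0 (PI / 2).
Proof.
intros Hr.
apply (ex_RInt_continuous (V := R_CompleteNormedModule)).
intros t _.
assert (Hpos : 0 < 1 - r ^ 2 * sin t ^ 2).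
{ pose proof (SIN_bound t) as Hs.
  assert (sin t ^ 2 <= 1) by nra.
  assert (r ^ 2 < 1) by nra.
  pose proof (pow2_ge_0 (sin t)); pose proof (pow2_ge_0 r); nra. }
apply (ex_derive_continuous (K := R_AbsRing) (V := R_NormedModule)).
auto_derive.
pose proof (sqrt_lt_R0 _ Hpos) as Hsq.
replace (1 + - (r * (r * 1) * (sin t * (sin t * 1))))
  with (1 - r ^ 2 * sin t ^ 2) by ring.
repeat split; try lra.
Qed.

(* Main.v *)
Require Import Defs.
From Stdlib Require Import Reals Lra.
From Coquelicot Require Import Coquelicot.

Open Scope R_scope.

(* Put x = r', D(x,t) = sqrt (cos^2 t + x^2 sin^2 t), and let F and A be the
   integrals over (0, pi/2) of 1/D and cos^2/D, so that K(r) = F(x); let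
   G(x) = ln (1 + 4/x).  Since sin cos / D vanishes at both ends, integrating
   its derivative gives F' = - A/x and (1 - x^2) A' = x (2A - F).  Hence
   (F/G)' = - P / (x G^2) with P = A G - 4F/(x+4), and
     ((1 - x^2) P)' = x F M,   M = 4 (x^2 + 8x + 1) / (x (x+4)^2) - G.
   The elementary function M is first positive and then negative on (0, 1),
   because M' has the sign of -4x^2 + 13x - 4 and M(1) = 8/5 - ln 5 < 0.  So
   (1 - x^2) P first increases and then decreases; its lower limits at 0 and 1
   are nonnegative, so P > 0 and F/G is strictly decreasing.  The behaviour at
   0 comes from ln (4/x) / sqrt (1 + x) <= F <= G + x/4. *)

(** * The kernel D and the integrals F and A *)

Definition legDelta (x t : R) : R := sqrt (cos t ^ 2 + x ^ 2 * sin t ^ 2).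

Definition ellipticF (x : R) : R := RInt (fun t => 1 / legDelta x t) 0 (PI / 2).

(** With r^2 = 1 - x^2 this is the classical (E - x^2 K) / r^2, where E is the complete integral of
    the second kind, since D^2 = x^2 + r^2 cos^2 t. *)
Definition ellipticA (x : R) : R :=
  RInt (fun t => cos t ^ 2 / legDelta x t) 0 (PI / 2).

Definition logG (x : R) : R := ln (1 + 4 / x).

Lemma sin2_cos2_pow (t : R) : sin t ^ 2 + cos t ^ 2 = 1.
Proof. pose proof (sin2_cos2 t); unfold Rsqr in *; nra. Qed.

Lemma quad_pos (x t : R) : x <> 0 -> 0 < cos t ^ 2 + x ^ 2 * sin t ^ 2.
Proof.
intros Hx.
pose proof (sin2_cos2_pow t) as H.
pose proof (pow2_gt_0 x Hx).
pose proof (pow2_ge_0 (sin t)); pose proof (pow2_ge_0 (cos t)).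
destruct (Rle_lt_or_eq_dec 0 (sin t ^ 2)) as [Hs|Hs]; trivial; nra.
Qed.

Lemma Delta_pos (x t : R) : x <> 0 -> 0 < legDelta x t.
Proof. intros Hx; apply sqrt_lt_R0, quad_pos, Hx. Qed.

Lemma Delta_sqr (x t : R) : legDelta x t ^ 2 = cos t ^ 2 + x ^ 2 * sin t ^ 2.
Proof.
unfold legDelta; apply pow2_sqrt.
pose proof (pow2_ge_0 (sin t)); pose proof (pow2_ge_0 (cos t)).
pose proof (pow2_ge_0 x); nra.
Qed.

Lemma continuous_Delta (x t : R) : x <> 0 -> continuous (legDelta x) t.
Proof.
intros Hx.
apply (ex_derive_continuous (K := R_AbsRing) (V := R_NormedModule)).
unfold legDelta; auto_derive.
pose proof (quad_pos x t Hx); simpl in *; lra.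
Qed.

Lemma continuous_Rdiv (f g : R -> R) (t : R) :
  continuous f t -> continuous g t -> g t <> 0 ->
  continuous (fun u => f u / g u) t.
Proof.
intros Hf Hg Hn.
apply (continuous_mult (K := R_AbsRing)); trivial.
now apply continuous_Rinv_comp.
Qed.

Lemma continuous_div_Delta (g : R -> R) (x t : R) :
  x <> 0 -> continuous g t -> continuous (fun t => g t / legDelta x t) t.
Proof.
intros Hx Hg; apply continuous_Rdiv; trivial.
- now apply continuous_Delta.
- pose proof (Delta_pos x t Hx); lra.
Qed.

Lemma ex_RInt_div_Delta (g : R -> R) (x a b : R) :
  x <> 0 -> (forall t, continuous g t) ->
  ex_RInt (fun t => g t / legDelta x t) a b.
Proof.
intros Hx Hg; apply (ex_RInt_continuous (V := R_CompleteNormedModule)).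
intros t _; now apply continuous_div_Delta.
Qed.

(** * Differentiation under the integral sign *)

Lemma is_derive_div_Delta (g : R -> R) (x t : R) : x <> 0 ->
  is_derive (fun u => g t / legDelta u t) x
    (- (x * sin t ^ 2 * g t) / legDelta x t ^ 3).
Proof.
intros Hx; pose proof (quad_pos x t Hx) as Hq.
pose proof (Delta_pos x t Hx) as HD; pose proof (Delta_sqr x t) as HS.
unfold legDelta at 1; auto_derive.
- simpl in *; split; [lra|split; trivial].
  apply Rgt_not_eq, sqrt_lt_R0; lra.
- replace (cos t * (cos t * 1) + x * (x * 1) * (sin t * (sin t * 1)))
    with (cos t ^ 2 + x ^ 2 * sin t ^ 2) by ring.
  fold (legDelta x t); field; lra.
Qed.

Lemma continuity_2d_pt_pow (f : R -> R -> R) (n : nat) (x y : R) :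
  continuity_2d_pt f x y -> continuity_2d_pt (fun u v => f u v ^ n) x y.
Proof.
intros Hf; induction n as [|n IH]; simpl.
- apply continuity_2d_pt_const.
- now apply continuity_2d_pt_mult.
Qed.

Lemma continuity_2d_pt_snd (g : R -> R) (x y : R) :
  continuity_pt g y -> continuity_2d_pt (fun _ v => g v) x y.
Proof.
intros Hg; apply (continuity_1d_2d_pt_comp g (fun _ v => v)); trivial.
apply continuity_2d_pt_id2.
Qed.

Lemma continuity_2d_pt_Delta (x t : R) :
  x <> 0 -> continuity_2d_pt legDelta x t.
Proof.
intros Hx; unfold legDelta.
apply (continuity_1d_2d_pt_comp sqrt
         (fun u v => cos v ^ 2 + u ^ 2 * sin v ^ 2)).
- apply continuity_pt_sqrt; left; now apply quad_pos.
- apply continuity_2d_pt_plus.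
  + apply continuity_2d_pt_pow, continuity_2d_pt_snd, continuity_cos.
  + apply continuity_2d_pt_mult; apply continuity_2d_pt_pow.
    * apply continuity_2d_pt_id1.
    * apply continuity_2d_pt_snd, continuity_sin.
Qed.

Lemma is_derive_RInt_div_Delta (g : R -> R) (a b x : R) :
  0 < x -> (forall t, continuous g t) ->
  is_derive (fun u => RInt (fun t => g t / legDelta u t) a b) x
    (RInt (fun t => - (x * sin t ^ 2 * g t) / legDelta x t ^ 3) a b).
Proof.
intros Hx Hg.
assert (Hloc : locally x (fun u : R => 0 < u)) by now apply open_gt.
rewrite <- (RInt_ext (fun t => Derive (fun u => g t / legDelta u t) x)).
2: { intros t _; apply is_derive_unique, is_derive_div_Delta; lra. }
apply (is_derive_RInt_param (fun u t => g t / legDelta u t)).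
- apply filter_imp with (2 := Hloc); intros u Hu t _.
  eexists; apply is_derive_div_Delta; lra.
- intros t _.
  apply continuity_2d_pt_ext_loc
    with (fun u v => - (u * sin v ^ 2 * g v) * / legDelta u v ^ 3).
  + assert (HD : legDelta x t <> 0) by (pose proof (Delta_pos x t); lra).
    (* The radius x keeps u positive on the whole neighbourhood, so the derivative formula holds
       there. *)
    exists (mkposreal x Hx); simpl; intros u v Hu _.
    symmetry; apply is_derive_unique, is_derive_div_Delta.
    apply Rabs_lt_between in Hu; lra.
  + apply continuity_2d_pt_mult.
    * apply continuity_2d_pt_opp, continuity_2d_pt_mult.
      -- apply continuity_2d_pt_mult; [apply continuity_2d_pt_id1|].
         apply continuity_2d_pt_pow, continuity_2d_pt_snd, continuity_sin.
      -- apply continuity_2d_pt_snd, continuity_pt_filterlim, Hg.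
    * apply continuity_2d_pt_inv.
      -- apply continuity_2d_pt_pow, continuity_2d_pt_Delta; lra.
      -- apply pow_nonzero; pose proof (Delta_pos x t); lra.
- apply filter_imp with (2 := Hloc); intros u Hu.
  apply ex_RInt_div_Delta; trivial; lra.
Qed.

Lemma continuous_const1 (t : R) : continuous (fun _ : R => 1) t.
Proof. apply continuous_const. Qed.

Lemma continuous_cos2 (t : R) : continuous (fun t => cos t ^ 2) t.
Proof.
apply (ex_derive_continuous (K := R_AbsRing) (V := R_NormedModule)).
now auto_derive.
Qed.

(** * Derivatives of F and A *)

Lemma is_derive_sin_cos_div_Delta (x t : R) : x <> 0 ->
  is_derive (fun t => sin t * cos t / legDelta x t) t
    ((cos t ^ 4 - x ^ 2 * sin t ^ 4) / legDelta x t ^ 3).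
Proof.
intros Hx; pose proof (quad_pos x t Hx) as Hq.
pose proof (Delta_pos x t Hx) as HD; pose proof (Delta_sqr x t) as HS.
unfold legDelta at 1; auto_derive.
- simpl in *; split; [lra|split; trivial].
  apply Rgt_not_eq, sqrt_lt_R0; lra.
- replace (cos t * (cos t * 1) + x * (x * 1) * (sin t * (sin t * 1)))
    with (cos t ^ 2 + x ^ 2 * sin t ^ 2) by ring.
  fold (legDelta x t).
  (* The right-hand form is what the quotient rule yields, since D D' = - (1 - x^2) sin t cos t for
     the t-derivative D'. *)
  replace (cos t ^ 4 - x ^ 2 * sin t ^ 4)
    with ((cos t ^ 2 - sin t ^ 2) * legDelta x t ^ 2
          + (1 - x ^ 2) * sin t ^ 2 * cos t ^ 2) by (rewrite HS; ring).
  field; lra.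
Qed.

Lemma is_RInt_sin_cos_div_Delta (x : R) : x <> 0 ->
  is_RInt (fun t => (cos t ^ 4 - x ^ 2 * sin t ^ 4) / legDelta x t ^ 3)
    0 (PI / 2) 0.
Proof.
intros Hx.
replace 0 with (minus (sin (PI / 2) * cos (PI / 2) / legDelta x (PI / 2))
                  (sin 0 * cos 0 / legDelta x 0)) at 2.
2: { rewrite cos_PI2, sin_0; unfold minus, plus, opp; simpl.
     unfold Rdiv; ring. }
apply (is_RInt_derive (fun t => sin t * cos t / legDelta x t)).
- intros t _; now apply is_derive_sin_cos_div_Delta.
- intros t _; apply continuous_Rdiv.
  + apply (ex_derive_continuous (K := R_AbsRing) (V := R_NormedModule)).
    now auto_derive.
  + apply (continuous_comp (legDelta x) (fun z => z ^ 3)).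
    * now apply continuous_Delta.
    * apply (ex_derive_continuous (K := R_AbsRing) (V := R_NormedModule)).
      now auto_derive.
  + apply pow_nonzero; pose proof (Delta_pos x t Hx); lra.
Qed.

(** With N = (cos^4 - x^2 sin^4) / D^3, whose integral vanishes, the differentiated integrand
    satisfies - x sin^2 / D^3 = (N - cos^2 / D) / x. *)
Lemma is_derive_ellipticF (x : R) : 0 < x ->
  is_derive ellipticF x (- ellipticA x / x).
Proof.
intros Hx; assert (Hx0 : x <> 0) by lra.
unfold ellipticF.
replace (- ellipticA x / x)
  with (RInt (fun t => - (x * sin t ^ 2 * 1) / legDelta x t ^ 3) 0 (PI / 2)).
{ apply (is_derive_RInt_div_Delta (fun _ => 1)); trivial.
  apply continuous_const1. }
apply is_RInt_unique.
replace (- ellipticA x / x)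
  with (scal (/ x) (minus 0 (ellipticA x)))
  by (unfold scal, minus, plus, opp; simpl; unfold mult; simpl; field; lra).
apply is_RInt_ext with
  (fun t => scal (/ x)
     (minus ((cos t ^ 4 - x ^ 2 * sin t ^ 4) / legDelta x t ^ 3)
        (cos t ^ 2 / legDelta x t))).
2: { apply (is_RInt_scal (V := R_NormedModule)),
       (is_RInt_minus (V := R_NormedModule)).
     - now apply is_RInt_sin_cos_div_Delta.
     - apply (RInt_correct (V := R_CompleteNormedModule)).
       apply ex_RInt_div_Delta; trivial; apply continuous_cos2. }
intros t _; unfold scal, minus, plus, opp; simpl; unfold mult; simpl.
pose proof (Delta_pos x t Hx0) as HD; pose proof (Delta_sqr x t) as HS.
replace (cos t * (cos t * 1) / legDelta x t)
  with (cos t ^ 2 * legDelta x t ^ 2 / legDelta x t ^ 3) by (field; lra).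
rewrite HS; field_simplify_eq; [|lra].
replace (cos t ^ 4) with (cos t ^ 2 * cos t ^ 2) by ring.
pose proof (sin2_cos2_pow t) as H.
replace (cos t ^ 2) with (1 - sin t ^ 2) by lra; ring.
Qed.

(** With the same N of zero integral, the differentiated integrand satisfies - x sin^2 cos^2 / D^3 =
    x / (1 - x^2) (2 cos^2 / D - 1 / D - N). *)
Lemma is_derive_ellipticA (x : R) : 0 < x < 1 ->
  is_derive ellipticA x (x * (2 * ellipticA x - ellipticF x) / (1 - x ^ 2)).
Proof.
intros Hx; assert (Hx0 : x <> 0) by lra.
assert (Hx2 : 1 - x ^ 2 <> 0) by nra.
unfold ellipticA at 1.
replace (x * (2 * ellipticA x - ellipticF x) / (1 - x ^ 2))
  with (RInt (fun t => - (x * sin t ^ 2 * cos t ^ 2) / legDelta x t ^ 3)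
          0 (PI / 2)).
{ apply (is_derive_RInt_div_Delta (fun t => cos t ^ 2)); try lra.
  apply continuous_cos2. }
apply is_RInt_unique.
replace (x * (2 * ellipticA x - ellipticF x) / (1 - x ^ 2))
  with (scal (x / (1 - x ^ 2)) (minus (minus (scal 2 (ellipticA x))
          (ellipticF x)) 0))
  by (unfold scal, minus, plus, opp; simpl; unfold mult; simpl; field; lra).
apply is_RInt_ext with
  (fun t => scal (x / (1 - x ^ 2))
     (minus (minus (scal 2 (cos t ^ 2 / legDelta x t)) (1 / legDelta x t))
        ((cos t ^ 4 - x ^ 2 * sin t ^ 4) / legDelta x t ^ 3))).
2: { apply (is_RInt_scal (V := R_NormedModule)),
       (is_RInt_minus (V := R_NormedModule)).
     - apply (is_RInt_minus (V := R_NormedModule)).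
       + apply (is_RInt_scal (V := R_NormedModule)).
         apply (RInt_correct (V := R_CompleteNormedModule)).
         apply ex_RInt_div_Delta; trivial; apply continuous_cos2.
       + apply (RInt_correct (V := R_CompleteNormedModule)).
         apply (ex_RInt_div_Delta (fun _ => 1)); trivial.
         apply continuous_const1.
     - now apply is_RInt_sin_cos_div_Delta. }
intros t _; unfold scal, minus, plus, opp; simpl; unfold mult; simpl.
pose proof (Delta_pos x t Hx0) as HD; pose proof (Delta_sqr x t) as HS.
replace (cos t * (cos t * 1) / legDelta x t)
  with (cos t ^ 2 * legDelta x t ^ 2 / legDelta x t ^ 3) by (field; lra).
replace (1 / legDelta x t)
  with (legDelta x t ^ 2 / legDelta x t ^ 3) by (field; lra).
rewrite HS; field_simplify_eq; [|simpl in *; lra].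
replace (cos t ^ 4) with (cos t ^ 2 * cos t ^ 2) by ring.
pose proof (sin2_cos2_pow t) as H.
replace (cos t ^ 2) with (1 - sin t ^ 2) by lra; ring.
Qed.

(** * Elementary bounds for D, A and F *)

Lemma cos_le_Delta (x t : R) : cos t <= legDelta x t.
Proof.
destruct (Rle_dec (cos t) 0) as [Hc|Hc].
- apply Rle_trans with 0; [lra|apply sqrt_pos].
- rewrite <- (sqrt_pow2 (cos t)) by lra; apply sqrt_le_1_alt.
  pose proof (pow2_ge_0 (sin t)); pose proof (pow2_ge_0 x); nra.
Qed.

Lemma Delta_le_plus (x t : R) : 0 <= x -> 0 <= sin t -> 0 <= cos t ->
  legDelta x t <= cos t + x * sin t.
Proof.
intros Hx Hs Hc.
assert (0 <= x * sin t) by nra.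
rewrite <- (sqrt_pow2 (cos t + x * sin t)) by lra.
apply sqrt_le_1_alt; nra.
Qed.

(** From cos t <= D <= cos t + x follows cos^2 t / D >= cos t - x; integration gives 1 - x PI / 2,
    and PI <= 4. *)
Lemma ellipticA_ge (x : R) : 0 < x -> 1 - 2 * x <= ellipticA x.
Proof.
intros Hx; assert (Hx0 : x <> 0) by lra.
assert (HI : is_RInt (fun t => cos t - x) 0 (PI / 2) (1 - x * (PI / 2))).
{ replace (1 - x * (PI / 2))
    with (minus (sin (PI / 2) - x * (PI / 2)) (sin 0 - x * 0))
    by (rewrite sin_PI2, sin_0; unfold minus, plus, opp; simpl; ring).
  apply (is_RInt_derive (fun t => sin t - x * t)).
  - intros t _; auto_derive; [trivial|ring].
  - intros t _.
    apply (ex_derive_continuous (K := R_AbsRing) (V := R_NormedModule)).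
    now auto_derive. }
pose proof PI_4; pose proof PI_RGT_0.
apply Rle_trans with (1 - x * (PI / 2)); [nra|].
rewrite <- (is_RInt_unique _ _ _ _ HI).
apply RInt_le; [lra|now eexists; apply HI| |].
{ apply ex_RInt_div_Delta; trivial; apply continuous_cos2. }
intros t Ht.
assert (Hs : 0 < sin t) by (apply sin_gt_0; lra).
assert (Hc : 0 < cos t) by (apply cos_gt_0; lra).
pose proof (Delta_pos x t Hx0).
pose proof (cos_le_Delta x t).
pose proof (Delta_le_plus x t) as Hle.
pose proof (SIN_bound t).
assert (legDelta x t <= cos t + x) by nra.
apply Rmult_le_reg_r with (legDelta x t); trivial.
unfold Rdiv; rewrite Rmult_assoc, Rinv_l, Rmult_1_r by lra.
(* [cos (legDelta - cos) <= x cos <= x legDelta] *)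
nra.
Qed.

(** D >= x when x <= 1, and PI / 2 <= 2. This crude bound serves near x = 1 only. *)
Lemma ellipticF_le_inv (x : R) : 0 < x <= 1 -> ellipticF x <= 2 / x.
Proof.
intros Hx; assert (Hx0 : x <> 0) by lra.
pose proof PI_4; pose proof PI_RGT_0.
apply Rle_trans with (RInt (fun _ => / x) 0 (PI / 2)).
- apply RInt_le; [lra| |apply ex_RInt_const|].
  { apply (ex_RInt_div_Delta (fun _ => 1)); trivial; apply continuous_const1. }
  intros t _; unfold Rdiv; rewrite Rmult_1_l.
  apply Rinv_le_contravar; [lra|].
  rewrite <- (sqrt_pow2 x) at 1 by lra; apply sqrt_le_1_alt.
  pose proof (pow2_ge_0 (cos t)).
  replace (sin t ^ 2) with (1 - cos t ^ 2)
    by (pose proof (sin2_cos2_pow t); lra).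
  assert (x ^ 2 <= 1) by nra; nra.
- rewrite RInt_const; unfold scal; simpl; unfold mult; simpl.
  apply Rmult_le_compat_r; [left; apply Rinv_0_lt_compat|]; lra.
Qed.

(** * Logarithmic bounds for F *)

Lemma is_derive_arcsinh (y : R) : is_derive arcsinh y (/ sqrt (y ^ 2 + 1)).
Proof. apply is_derive_Reals, derivable_pt_lim_arcsinh. Qed.

Lemma is_RInt_inv_cos (b : R) : 0 <= b < PI / 2 ->
  is_RInt (fun t => / cos t) 0 b (arcsinh (tan b)).
Proof.
intros Hb.
replace (arcsinh (tan b)) with (minus (arcsinh (tan b)) (arcsinh (tan 0)))
  by (rewrite tan_0, arcsinh_0; unfold minus, plus, opp; simpl; ring).
pose proof PI_RGT_0.
apply (is_RInt_derive (fun t => arcsinh (tan t)));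
  intros t; rewrite Rmin_left, Rmax_right by lra; intros Ht;
  (assert (Hc : 0 < cos t) by (apply cos_gt_0; lra)).
- replace (/ cos t) with (scal (tan t ^ 2 + 1) (/ sqrt (tan t ^ 2 + 1))).
  + apply (is_derive_comp arcsinh tan); [apply is_derive_arcsinh|].
    apply is_derive_tan; lra.
  + unfold scal; simpl; unfold mult; simpl.
    replace (tan t * (tan t * 1) + 1) with ((/ cos t) ^ 2).
    2: { unfold tan; field_simplify_eq; [|lra].
         pose proof (sin2_cos2_pow t); lra. }
    rewrite sqrt_pow2 by (left; now apply Rinv_0_lt_compat).
    field; lra.
- apply continuous_Rinv_comp; [|lra].
  apply (ex_derive_continuous (K := R_AbsRing) (V := R_NormedModule)).
  now auto_derive.
Qed.

(** The substitution tan u = 1 / (x tan t) turns this into the integral of 1 / cos u. Concretely, w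
    = cos t / (x sin t) satisfies sqrt (w^2 + 1) = D / (x sin t). *)
Lemma is_RInt_inv_sin_Delta (x a : R) : 0 < x -> 0 < a <= PI / 2 ->
  is_RInt (fun t => / sin t / legDelta x t) a (PI / 2)
    (arcsinh (cos a / (x * sin a))).
Proof.
intros Hx Ha.
replace (arcsinh (cos a / (x * sin a)))
  with (minus (- arcsinh (cos (PI / 2) / (x * sin (PI / 2))))
              (- arcsinh (cos a / (x * sin a)))).
2: { rewrite cos_PI2; unfold Rdiv at 1; rewrite Rmult_0_l, arcsinh_0.
     unfold minus, plus, opp; simpl; ring. }
pose proof PI_RGT_0.
apply (is_RInt_derive (fun t => - arcsinh (cos t / (x * sin t))));
  intros t; rewrite Rmin_left, Rmax_right by lra; intros Ht;
  (assert (Hs : 0 < sin t) by (apply sin_gt_0; lra));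
  (assert (HD : 0 < legDelta x t) by (apply Delta_pos; lra)).
- assert (Hxs : 0 < x * sin t) by nra.
  replace (/ sin t / legDelta x t)
    with (opp (scal (- / (x * sin t ^ 2))
                 (/ sqrt ((cos t / (x * sin t)) ^ 2 + 1)))).
  + apply (is_derive_opp (K := R_AbsRing) (V := R_NormedModule)).
    apply (is_derive_comp arcsinh (fun t => cos t / (x * sin t)));
      [apply is_derive_arcsinh|].
    auto_derive; [lra|].
    pose proof (sin2_cos2_pow t) as H2.
    field_simplify_eq; [|lra].
    replace (cos t ^ 2) with (1 - sin t ^ 2) by lra; ring.
  + unfold scal, opp; simpl; unfold mult; simpl.
    replace (cos t / (x * sin t) * (cos t / (x * sin t) * 1) + 1)
      with ((legDelta x t / (x * sin t)) ^ 2).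
    2: { unfold Rdiv at 1; rewrite Rpow_mult_distr, Delta_sqr; field; lra. }
    rewrite sqrt_pow2 by (left; now apply Rdiv_lt_0_compat).
    field; lra.
- apply (continuous_div_Delta (fun t => / sin t)); [lra|].
  apply continuous_Rinv_comp; [|lra].
  apply (ex_derive_continuous (K := R_AbsRing) (V := R_NormedModule)).
  now auto_derive.
Qed.

(* The integrand is squeezed between elementary ones on either side of
   [atan (1 / sqrt x)], the fixed point of the symmetry
   [tan t -> 1 / (x tan t)]. *)
Lemma ellipticF_bounds (x : R) : 0 < x ->
  2 * arcsinh (/ sqrt x) / sqrt (1 + x) <= ellipticF x
    <= 2 * arcsinh (/ sqrt x).
Proof.
intros Hx; assert (Hx0 : x <> 0) by lra.
pose proof (sqrt_lt_R0 x Hx) as Hsx.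
assert (Hsx2 : sqrt x * sqrt x = x) by (apply sqrt_sqrt; lra).
assert (Hk : 0 < sqrt (1 + x)) by (apply sqrt_lt_R0; lra).
assert (Hk2 : sqrt (1 + x) ^ 2 = 1 + x) by (apply pow2_sqrt; lra).
set (t0 := atan (/ sqrt x)).
pose proof (atan_bound (/ sqrt x)) as Hb; fold t0 in Hb.
assert (Ht0 : 0 < t0).
{ unfold t0; rewrite <- atan_0; apply atan_increasing.
  now apply Rinv_0_lt_compat. }
assert (Htan : tan t0 = / sqrt x) by apply tan_atan.
assert (Hs0 : 0 < sin t0) by (apply sin_gt_0; lra).
assert (Hc0 : 0 < cos t0) by (apply cos_gt_0; lra).
assert (Hcs : sin t0 * sqrt x = cos t0).
{ unfold tan in Htan.
  replace (sin t0) with (sin t0 / cos t0 * cos t0) by (field; lra).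
  rewrite Htan; field; lra. }
assert (Hs2 : sin t0 ^ 2 * (1 + x) = 1).
{ pose proof (sin2_cos2_pow t0); rewrite <- Hcs in *; nra. }
pose proof (is_RInt_inv_cos t0) as I1; rewrite Htan in I1.
specialize (I1 ltac:(lra)).
pose proof (is_RInt_inv_sin_Delta x t0 Hx ltac:(lra)) as I2.
replace (cos t0 / (x * sin t0)) with (/ sqrt x) in I2.
2: { rewrite <- Hcs; field_simplify_eq; simpl; lra. }
(* At t0 both comparison integrals take this same value, which explains the factor 2. *)
set (y := arcsinh (/ sqrt x)) in *.
assert (HF : forall a b, ex_RInt (fun t => 1 / legDelta x t) a b).
{ intros a b; apply (ex_RInt_div_Delta (fun _ => 1)); trivial.
  apply continuous_const1. }
unfold ellipticF.
rewrite <- (RInt_Chasles _ 0 t0 (PI / 2) (HF _ _) (HF _ _)).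
unfold plus; simpl.
assert (J1 := is_RInt_scal (V := R_NormedModule) _ _ _ (/ sqrt (1 + x)) _ I1).
assert (J2 := is_RInt_scal (V := R_NormedModule) _ _ _ (/ sqrt (1 + x)) _ I2).
unfold scal in J1, J2; simpl in J1, J2; unfold mult in J1, J2; simpl in J1, J2.
(* To the left of t0, (1 + x) sin^2 t <= 1, which is equivalent to D^2 <= (1 + x) cos^2 t. *)
assert (HL : forall t, 0 < t < t0 ->
  / sqrt (1 + x) * / cos t <= 1 / legDelta x t <= / cos t).
{ intros t Ht.
  assert (Hc : 0 < cos t) by (apply cos_gt_0; lra).
  assert (Hs : 0 < sin t) by (apply sin_gt_0; lra).
  assert (Hst : sin t < sin t0) by (apply sin_increasing_1; lra).
  pose proof (Delta_pos x t Hx0) as HD.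
  unfold Rdiv; rewrite Rmult_1_l, <- Rinv_mult.
  split; apply Rinv_le_contravar; try nra; [|apply cos_le_Delta].
  rewrite <- (sqrt_pow2 (cos t)), <- sqrt_mult_alt by lra.
  apply sqrt_le_1_alt.
  pose proof (sin2_cos2_pow t).
  assert (sin t ^ 2 * (1 + x) <= 1) by nra.
  nra. }
(* To the right of t0, 1 <= (1 + x) sin^2 t; after cancelling 1 / D the two bounds are this and sin
   t <= 1. *)
assert (HR : forall t, t0 < t < PI / 2 ->
  / sqrt (1 + x) * (/ sin t / legDelta x t) <= 1 / legDelta x t
    <= / sin t / legDelta x t).
{ intros t Ht.
  assert (Hst : sin t0 < sin t) by (apply sin_increasing_1; lra).
  pose proof (SIN_bound t).
  pose proof (Delta_pos x t Hx0) as HD.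
  assert (HD' : 0 <= / legDelta x t) by (left; now apply Rinv_0_lt_compat).
  unfold Rdiv; rewrite <- Rmult_assoc, <- Rinv_mult.
  replace (1 * / legDelta x t) with (/ 1 * / legDelta x t)
    by now rewrite Rinv_1.
  split; apply Rmult_le_compat_r; trivial.
  - apply Rinv_le_contravar; [lra|].
    assert (sin t0 ^ 2 <= sin t ^ 2) by nra.
    assert (1 <= (sqrt (1 + x) * sin t) ^ 2)
      by (rewrite Rpow_mult_distr, Hk2; nra).
    assert (0 < sqrt (1 + x) * sin t) by nra; nra.
  - apply Rinv_le_contravar; lra. }
split.
- replace (2 * y / sqrt (1 + x)) with (/ sqrt (1 + x) * y + / sqrt (1 + x) * y)
    by (field; lra).
  apply Rplus_le_compat.
  + rewrite <- (is_RInt_unique _ _ _ _ J1).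
    apply RInt_le; [lra|now eexists; apply J1|apply HF|].
    intros t Ht; now apply HL.
  + rewrite <- (is_RInt_unique _ _ _ _ J2).
    apply RInt_le; [lra|now eexists; apply J2|apply HF|].
    intros t Ht; now apply HR.
- replace (2 * y) with (y + y) by ring.
  apply Rplus_le_compat.
  + rewrite <- (is_RInt_unique _ _ _ _ I1).
    apply RInt_le; [lra|apply HF|now eexists; apply I1|].
    intros t Ht; now apply HL.
  + rewrite <- (is_RInt_unique _ _ _ _ I2).
    apply RInt_le; [lra|apply HF|now eexists; apply I2|].
    intros t Ht; now apply HR.
Qed.

Lemma ln_le_compat (a b : R) : 0 < a -> a <= b -> ln a <= ln b.
Proof.
intros Ha [H|H]; [left; now apply ln_increasing|right; now rewrite H].
Qed.

Lemma ln_1_plus_le (u : R) : -1 < u -> ln (1 + u) <= u.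
Proof.
intros Hu; rewrite <- (ln_exp u) at 2; apply ln_le_compat; [lra|].
apply exp_ineq1_le.
Qed.

(** With s = sqrt x and q = sqrt (1 / s^2 + 1), the middle term is ln ((1 / s + q)^2), and 1 / s <=
    q <= 1 / s + s / 2. The upper bound works out exactly, as (2 / s + s / 2)^2 = (1 + 4 / x) (1 + x
    / 4). *)
Lemma two_arcsinh_bounds (x : R) : 0 < x ->
  ln (4 / x) <= 2 * arcsinh (/ sqrt x) <= logG x + ln (1 + x / 4).
Proof.
intros Hx.
pose proof (sqrt_lt_R0 x Hx) as Hs.
assert (Hx2 : x = sqrt x ^ 2) by (symmetry; apply pow2_sqrt; lra).
set (s := sqrt x) in *.
assert (Hi : 0 < / s) by now apply Rinv_0_lt_compat.
assert (Hsi : s * / s = 1) by (apply Rinv_r; lra).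
unfold arcsinh.
assert (L : / s <= sqrt ((/ s) ^ 2 + 1)).
{ rewrite <- (sqrt_pow2 (/ s)) at 1 by lra; apply sqrt_le_1_alt; lra. }
assert (U : sqrt ((/ s) ^ 2 + 1) <= / s + s / 2).
{ rewrite <- (sqrt_pow2 (/ s + s / 2)) by lra; apply sqrt_le_1_alt; nra. }
set (q := sqrt ((/ s) ^ 2 + 1)) in *.
replace (2 * ln (/ s + q)) with (ln ((/ s + q) ^ 2))
  by (rewrite ln_pow by lra; simpl; ring).
unfold logG; rewrite <- ln_mult.
2: { apply Rplus_lt_0_compat; [lra|apply Rdiv_lt_0_compat; lra]. }
2: lra.
split; apply ln_le_compat.
- apply Rdiv_lt_0_compat; lra.
- replace (4 / x) with ((2 * / s) ^ 2) by (rewrite Hx2; field; lra).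
  apply pow_incr; lra.
- apply pow_lt; lra.
- replace ((1 + 4 / x) * (1 + x / 4)) with ((/ s + (/ s + s / 2)) ^ 2)
    by (rewrite Hx2; field; lra).
  apply pow_incr; lra.
Qed.

Lemma ellipticF_le_logG (x : R) : 0 < x -> ellipticF x <= logG x + x / 4.
Proof.
intros Hx.
pose proof (ellipticF_bounds x Hx); pose proof (two_arcsinh_bounds x Hx).
pose proof (ln_1_plus_le (x / 4)); lra.
Qed.

Lemma ellipticF_ge_ln (x : R) : 0 < x ->
  ln (4 / x) / sqrt (1 + x) <= ellipticF x.
Proof.
intros Hx.
apply Rle_trans with (2 * arcsinh (/ sqrt x) / sqrt (1 + x)).
- apply Rmult_le_compat_r; [|now apply two_arcsinh_bounds].
  left; apply Rinv_0_lt_compat, sqrt_lt_R0; lra.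
- now apply ellipticF_bounds.
Qed.

(** * Monotonicity from the derivative, and estimates for G *)

Lemma derive_pos_lt (f df : R -> R) (a b : R) : a < b ->
  (forall t, a <= t <= b -> is_derive f t (df t)) ->
  (forall t, a < t < b -> 0 < df t) -> f a < f b.
Proof.
intros Hab Hd Hp.
destruct (MVT_cor2 f df a b Hab) as [c [Hc Hc']].
- intros t Ht; now apply is_derive_Reals, Hd.
- specialize (Hp c Hc'); nra.
Qed.

Lemma derive_neg_lt (f df : R -> R) (a b : R) : a < b ->
  (forall t, a <= t <= b -> is_derive f t (df t)) ->
  (forall t, a < t < b -> df t < 0) -> f b < f a.
Proof.
intros Hab Hd Hp.
destruct (MVT_cor2 f df a b Hab) as [c [Hc Hc']].
- intros t Ht; now apply is_derive_Reals, Hd.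
- specialize (Hp c Hc'); nra.
Qed.

Lemma ln5_gt : 8 / 5 < ln 5.
Proof.
(* [ln 5 > - 160 ln (99/100) >= 160/100] *)
assert (H : ln (99 / 100) <= - (1 / 100)).
{ replace (99 / 100) with (1 + - (1 / 100)) by lra; apply ln_1_plus_le; lra. }
assert (H5 : / 5 < (99 / 100) ^ 160) by lra.
apply ln_increasing in H5; [|lra].
rewrite ln_Rinv, ln_pow in H5 by lra.
replace (INR 160) with 160 in H5 by (simpl; lra).
lra.
Qed.

Lemma logG_arg_gt1 (x : R) : 0 < x -> 1 < 1 + 4 / x.
Proof. intros Hx; assert (0 < 4 / x) by (apply Rdiv_lt_0_compat; lra); lra. Qed.

Lemma logG_pos (x : R) : 0 < x -> 0 < logG x.
Proof.
intros Hx; unfold logG; rewrite <- ln_1.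
apply ln_increasing; [lra|now apply logG_arg_gt1].
Qed.

Lemma logG_1 : logG 1 = ln 5.
Proof. unfold logG; f_equal; lra. Qed.

Lemma is_derive_logG (x : R) : 0 < x -> is_derive logG x (- 4 / (x * (x + 4))).
Proof.
intros Hx; pose proof (logG_arg_gt1 x Hx).
unfold logG; auto_derive; [lra|].
field; lra.
Qed.

(** 1 + 4 / z^2 <= (1 + 2 / z)^2. At x = z^2 it yields x G(x) <= 4 z, an explicit form of x G(x) ->
    0 at 0. *)
Lemma logG_le_sqr (z : R) : 0 < z -> logG (z ^ 2) <= 4 / z.
Proof.
intros Hz; assert (0 < 2 / z) by (apply Rdiv_lt_0_compat; lra).
apply Rle_trans with (ln ((1 + 2 / z) ^ 2)).
- pose proof (logG_arg_gt1 (z ^ 2)); apply ln_le_compat; [nra|].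
  replace (4 / z ^ 2) with ((2 / z) ^ 2) by (field; lra); nra.
- rewrite ln_pow by lra; simpl.
  pose proof (ln_1_plus_le (2 / z)); lra.
Qed.

(** Since ln (4 / x) >= 1 for x <= 1, G <= ln (4 / x) + x / 4 <= (1 + x) ln (4 / x); the second
    factor 1 + x bounds sqrt (1 + x). It shows that F/G has lower limit at least 1 at 0. *)
Lemma logG_le_ellipticF (x : R) : 0 < x <= 1 ->
  logG x <= (1 + x) ^ 2 * ellipticF x.
Proof.
intros Hx.
assert (HL : 1 <= ln (4 / x)).
{ rewrite <- (ln_exp 1); apply ln_le_compat; [apply exp_pos|].
  apply Rle_trans with 3; [apply exp_le_3|].
  apply Rmult_le_reg_r with x; [lra|].
  unfold Rdiv; rewrite Rmult_assoc, Rinv_l; lra. }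
assert (HG : logG x <= ln (4 / x) + x / 4).
{ unfold logG; replace (1 + 4 / x) with (4 / x * (1 + x / 4)) by (field; lra).
  rewrite ln_mult; [|apply Rdiv_lt_0_compat|]; try lra.
  pose proof (ln_1_plus_le (x / 4)); lra. }
assert (HF : ln (4 / x) <= (1 + x) * ellipticF x).
{ pose proof (ellipticF_ge_ln x ltac:(lra)) as HF.
  assert (Hs : 0 < sqrt (1 + x)) by (apply sqrt_lt_R0; lra).
  assert (Hs1 : sqrt (1 + x) <= 1 + x).
  { rewrite <- (sqrt_pow2 (1 + x)) at 2 by lra; apply sqrt_le_1_alt; nra. }
  replace (ln (4 / x)) with (ln (4 / x) / sqrt (1 + x) * sqrt (1 + x))
    by (field; lra).
  assert (0 < ln (4 / x) / sqrt (1 + x)) by (apply Rdiv_lt_0_compat; lra).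
  rewrite (Rmult_comm (1 + x)); apply Rmult_le_compat; lra. }
replace ((1 + x) ^ 2 * ellipticF x) with ((1 + x) * ((1 + x) * ellipticF x))
  by ring.
nra.
Qed.

Lemma ellipticF_pos (x : R) : 0 < x <= 1 -> 0 < ellipticF x.
Proof.
intros Hx; pose proof (logG_pos x ltac:(lra)).
pose proof (logG_le_ellipticF x Hx).
assert (0 < (1 + x) ^ 2) by (apply pow_lt; lra); nra.
Qed.

(** * Positivity of P = x (F G' - F' G) *)

Definition wronskian (x : R) : R :=
  ellipticA x * logG x - 4 * ellipticF x / (x + 4).

Definition wronskianM (x : R) : R :=
  4 * (x ^ 2 + 8 * x + 1) / (x * (x + 4) ^ 2) - logG x.

(** The weight makes every A cancel: ((1 - x^2) A)' = - x F, and the term with A G' cancels the one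
    with F'. Only multiples of F remain. *)
Lemma is_derive_weighted_wronskian (x : R) : 0 < x < 1 ->
  is_derive (fun x => (1 - x ^ 2) * wronskian x) x
    (ellipticF x * x * wronskianM x).
Proof.
intros Hx; unfold wronskian, wronskianM.
pose proof (is_derive_ellipticA x Hx) as HA.
pose proof (is_derive_ellipticF x ltac:(lra)) as HF.
pose proof (is_derive_logG x ltac:(lra)) as HG.
auto_derive.
- repeat split; try (eexists; eassumption); lra.
- rewrite (is_derive_unique (fun x : R => ellipticA x) _ _ HA),
    (is_derive_unique (fun x : R => ellipticF x) _ _ HF),
    (is_derive_unique (fun x : R => logG x) _ _ HG).
  field; repeat split; nra.
Qed.

Lemma is_derive_wronskianM (x : R) : 0 < x ->
  is_derive wronskianM x
    (4 / (x ^ 2 * (x + 4) ^ 3) * (- 4 * x ^ 2 + 13 * x - 4)).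
Proof.
intros Hx; unfold wronskianM.
pose proof (is_derive_logG x ltac:(lra)) as HG.
auto_derive.
- repeat split; try (eexists; eassumption).
  apply Rgt_not_eq; assert (0 < (x + 4) ^ 2) by (apply pow_lt; lra).
  simpl in *; nra.
- rewrite (is_derive_unique (fun x : R => logG x) _ _ HG); field; lra.
Qed.

(** The quadratic in M' increases on (0, 1). If it is nonpositive at y, M decreases on (0, y), so
    M(x) > M(y). If it is positive at y, M increases on (y, 1), so M(y) < M(1) = 8/5 - ln 5 < 0, a
    contradiction. *)
Lemma wronskianM_down_closed (x y : R) : 0 < x -> x < y -> y < 1 ->
  0 <= wronskianM y -> 0 < wronskianM x.
Proof.
intros Hx Hxy Hy HM.
assert (Hk : forall t, 0 < t -> 0 < 4 / (t ^ 2 * (t + 4) ^ 3)).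
{ intros t Ht; apply Rdiv_lt_0_compat; [lra|].
  apply Rmult_lt_0_compat; apply pow_lt; lra. }
destruct (Rle_dec (- 4 * y ^ 2 + 13 * y - 4) 0) as [Hq|Hq].
- apply Rle_lt_trans with (1 := HM).
  eapply derive_neg_lt; [exact Hxy| |].
  + intros t Ht; apply is_derive_wronskianM; lra.
  + intros t Ht; simpl; specialize (Hk t ltac:(lra)).
    assert (- 4 * t ^ 2 + 13 * t - 4 < 0) by nra.
    simpl in *; nra.
- exfalso.
  assert (H1 : wronskianM y < wronskianM 1).
  { eapply derive_pos_lt; [exact Hy| |].
    - intros t Ht; apply is_derive_wronskianM; lra.
    - intros t Ht; apply Rmult_lt_0_compat; [apply Hk; lra|nra]. }
  unfold wronskianM in H1 at 2; rewrite logG_1 in H1.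
  pose proof ln5_gt; lra.
Qed.

(** P >= A G - F >= (1 - 2x) G - G - x / 4 = - 2 x G - x / 4. Writing x = z^2 bounds x G by 4 z and
    x by z, whence the constant 9. *)
Lemma wronskian_lower_0 (z : R) : 0 < z < 1 ->
  - (9 * z) <= (1 - (z ^ 2) ^ 2) * wronskian (z ^ 2).
Proof.
intros Hz; set (x := z ^ 2).
assert (Hx : 0 < x < 1) by (unfold x; nra).
assert (H : - (9 * z) <= wronskian x).
{ pose proof (ellipticA_ge x ltac:(lra)) as HA.
  pose proof (ellipticF_le_logG x ltac:(lra)) as HF.
  pose proof (ellipticF_pos x ltac:(lra)) as HFp.
  pose proof (logG_pos x ltac:(lra)) as HG.
  assert (HG2 : x * logG x <= 4 * z).
  { replace (4 * z) with (x * (4 / z)) by (unfold x; field; lra).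
    apply Rmult_le_compat_l; [lra|apply logG_le_sqr; lra]. }
  assert (4 * ellipticF x / (x + 4) <= ellipticF x).
  { apply Rmult_le_reg_r with (x + 4); [lra|].
    unfold Rdiv; rewrite Rmult_assoc, Rinv_l; nra. }
  assert (x <= z) by (unfold x; nra).
  unfold wronskian; nra. }
assert (0 < 1 - x ^ 2 <= 1) by nra.
nra.
Qed.

(** As A and G are nonnegative, P >= - F >= - 2 / x >= - 4, while 1 - x^2 <= 2 (1 - x). *)
Lemma wronskian_lower_1 (x : R) : 1 / 2 <= x < 1 ->
  - (8 * (1 - x)) <= (1 - x ^ 2) * wronskian x.
Proof.
intros Hx.
pose proof (ellipticA_ge x ltac:(lra)).
pose proof (ellipticF_le_inv x ltac:(lra)) as HF.
pose proof (logG_pos x ltac:(lra)) as HG.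
pose proof (ellipticF_pos x ltac:(lra)) as HFp.
assert (HA : 0 <= ellipticA x).
{ pose proof PI_RGT_0; apply RInt_ge_0; [lra| |].
  - apply ex_RInt_div_Delta; [lra|apply continuous_cos2].
  - intros t _; apply Rdiv_le_0_compat; [apply pow2_ge_0|].
    apply Delta_pos; lra. }
assert (4 * ellipticF x / (x + 4) <= ellipticF x).
{ apply Rmult_le_reg_r with (x + 4); [lra|].
  unfold Rdiv; rewrite Rmult_assoc, Rinv_l; nra. }
assert (2 / x <= 4).
{ apply Rmult_le_reg_r with x; [lra|].
  unfold Rdiv; rewrite Rmult_assoc, Rinv_l; lra. }
assert (HP : - 4 <= wronskian x) by (unfold wronskian; nra).
assert (0 <= 1 - x ^ 2 <= 2 * (1 - x)) by nra.
nra.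
Qed.

(** The sign of M at x makes T = (1 - x^2) P increasing on (0, x] or decreasing on [x, 1), so T is
    followed from x to one end without locating its turning point. An intermediate point (x / 2 or
    m) makes the inequality strict. *)
Lemma wronskian_pos (x : R) : 0 < x < 1 -> 0 < wronskian x.
Proof.
intros Hx.
assert (Hx2 : 0 < 1 - x ^ 2) by nra.
enough (HT : 0 < (1 - x ^ 2) * wronskian x) by nra.
set (T := fun x => (1 - x ^ 2) * wronskian x).
change (0 < T x).
destruct (Rle_dec 0 (wronskianM x)) as [HM|HM].
- assert (Hinc : forall a b, 0 < a -> a < b -> b <= x -> T a < T b).
  { intros a b Ha Hab Hb; eapply derive_pos_lt; [exact Hab| |].
    - intros t Ht; apply is_derive_weighted_wronskian; lra.
    - intros t Ht; simpl.
      apply Rmult_lt_0_compat; [|apply wronskianM_down_closed with x; lra].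
      apply Rmult_lt_0_compat; [apply ellipticF_pos|]; lra. }
  pose proof (Hinc (x / 2) x ltac:(lra) ltac:(lra) ltac:(lra)) as H1.
  apply Rle_lt_trans with (2 := H1), Rnot_lt_le; intros Hn.
  (* If T(x / 2) < 0, this z gives T(z^2) >= - 9 z >= T(x / 2), although z^2 < x / 2. *)
  set (z := Rmin (x / 4) (- T (x / 2) / 9)).
  assert (Hz : 0 < z <= x / 4 /\ 9 * z <= - T (x / 2)).
  { unfold z; split; [split|].
    - apply Rmin_glb_lt; lra.
    - apply Rmin_l.
    - pose proof (Rmin_r (x / 4) (- T (x / 2) / 9)); lra. }
  pose proof (wronskian_lower_0 z ltac:(lra)) as H2.
  pose proof (Hinc (z ^ 2) (x / 2) ltac:(nra) ltac:(nra) ltac:(lra)) as H3.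
  unfold T in H3 at 1; lra.
- assert (Hdec : forall a b, x <= a -> a < b -> b < 1 -> T b < T a).
  { intros a b Ha Hab Hb; eapply derive_neg_lt; [exact Hab| |].
    - intros t Ht; apply is_derive_weighted_wronskian; lra.
    - intros t Ht; simpl.
      assert (0 < ellipticF t * t).
      { apply Rmult_lt_0_compat; [apply ellipticF_pos|]; lra. }
      assert (wronskianM t < 0).
      { apply Rnot_le_lt; intros Hp; apply HM; left.
        apply wronskianM_down_closed with t; lra. }
      nra. }
  assert (Hm : exists m, x < m < 1) by (exists ((x + 1) / 2); lra).
  destruct Hm as [m Hm].
  pose proof (Hdec x m ltac:(lra) ltac:(lra) ltac:(lra)) as H1.
  apply Rle_lt_trans with (2 := H1), Rnot_lt_le; intros Hn.
  (* If T(m) < 0, this y gives T(y) >= - 8 (1 - y) >= T(m), although m < y; also y > 1 / 2. *)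
  set (y := Rmax ((m + 1) / 2) (1 + T m / 8)).
  assert (Hy : (m + 1) / 2 <= y < 1 /\ 8 * (1 - y) <= - T m).
  { unfold y; split; [split|].
    - apply Rmax_l.
    - apply Rmax_lub_lt; lra.
    - pose proof (Rmax_r ((m + 1) / 2) (1 + T m / 8)); lra. }
  pose proof (wronskian_lower_1 y ltac:(lra)) as H2.
  pose proof (Hdec m y ltac:(lra) ltac:(lra) ltac:(lra)) as H3.
  unfold T in H3 at 1; lra.
Qed.

(** * The ratio F/G: monotonicity, bounds and range *)

Definition ratioH (x : R) : R := ellipticF x / logG x.

Lemma is_derive_ratioH (x : R) : 0 < x ->
  is_derive ratioH x (- wronskian x / (x * logG x ^ 2)).
Proof.
intros Hx; unfold ratioH, wronskian.
pose proof (is_derive_ellipticF x ltac:(lra)) as HF.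
pose proof (is_derive_logG x ltac:(lra)) as HG.
pose proof (logG_pos x Hx).
auto_derive.
- repeat split; try (eexists; eassumption); lra.
- rewrite (is_derive_unique (fun x : R => ellipticF x) _ _ HF),
    (is_derive_unique (fun x : R => logG x) _ _ HG).
  field; lra.
Qed.

(** The sign of P enters only on the open interval, so y = 1 is allowed and the lower bound of F/G
    becomes its value at 1. *)
Lemma ratioH_decr (x y : R) : 0 < x -> x < y -> y <= 1 -> ratioH y < ratioH x.
Proof.
intros Hx Hxy Hy; eapply derive_neg_lt; [exact Hxy| |].
- intros t Ht; apply is_derive_ratioH; lra.
- intros t Ht; simpl.
  pose proof (wronskian_pos t ltac:(lra)).
  pose proof (logG_pos t ltac:(lra)) as HG.
  assert (0 < / (t * (logG t * (logG t * 1)))).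
  { apply Rinv_0_lt_compat; apply Rmult_lt_0_compat; nra. }
  unfold Rdiv; nra.
Qed.

Lemma ratioH_1 : ratioH 1 = PI / (2 * ln 5).
Proof.
unfold ratioH, ellipticF; rewrite logG_1.
rewrite (RInt_ext _ (fun _ => 1)).
- rewrite RInt_const; unfold scal; simpl; unfold mult; simpl.
  pose proof ln5_gt; field; lra.
- intros t _; unfold legDelta.
  replace (cos t ^ 2 + 1 ^ 2 * sin t ^ 2) with 1
    by (pose proof (sin2_cos2_pow t); lra).
  rewrite sqrt_1; lra.
Qed.

Lemma logG_gt1 (x : R) : 0 < x <= 1 -> 1 < logG x.
Proof.
intros Hx; apply Rlt_le_trans with (ln 5); [pose proof ln5_gt; lra|].
apply ln_le_compat; [lra|].
apply Rmult_le_reg_r with x; [lra|].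
replace ((1 + 4 / x) * x) with (x + 4) by (field; lra); lra.
Qed.

(** By monotonicity it suffices that F/G <= 1 at x / 2. A value above 1 there would persist as the
    argument tends to 0, against F <= G + x / 4. *)
Lemma ratioH_lt_1 (x : R) : 0 < x < 1 -> ratioH x < 1.
Proof.
intros Hx.
apply Rlt_le_trans with (ratioH (x / 2)); [apply ratioH_decr; lra|].
apply Rnot_lt_le; intros Hn.
(* With this y, F(y) > (1 + y) G(y) > G(y) + y, because G > 1. *)
set (y := Rmin (x / 4) (ratioH (x / 2) - 1)).
assert (Hy : 0 < y <= x / 4) by
  (split; [apply Rmin_glb_lt; lra|apply Rmin_l]).
assert (Hy2 : y <= ratioH (x / 2) - 1) by apply Rmin_r.
pose proof (ratioH_decr y (x / 2) ltac:(lra) ltac:(lra) ltac:(lra)) as H1.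
pose proof (ellipticF_le_logG y ltac:(lra)) as H2.
pose proof (logG_gt1 y ltac:(lra)) as H3.
assert (ellipticF y = ratioH y * logG y) by (unfold ratioH; field; lra).
nra.
Qed.

Lemma ratioH_gt (c : R) : c < 1 -> exists x, 0 < x < 1 /\ c < ratioH x.
Proof.
intros Hc.
assert (Hx : exists x, 0 < x < 1 /\ c * (1 + x) ^ 2 < 1).
{ destruct (Rle_dec c 0).
  - exists (1 / 2); split; [lra|nra].
  (* For 0 < c < 1 this x is below 1/4, so (1 + x)^2 <= 1 + 3x and c (1 + 3x) < c + (1 - c) = 1. *)
  - exists ((1 - c) / 4); split; [lra|].
    assert ((1 + (1 - c) / 4) ^ 2 <= 1 + 3 * ((1 - c) / 4)) by nra; nra. }
destruct Hx as [x [Hx Hcx]]; exists x; split; trivial.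
pose proof (logG_pos x ltac:(lra)) as HG.
pose proof (logG_le_ellipticF x ltac:(lra)) as HF.
pose proof (ellipticF_pos x ltac:(lra)).
assert (Hp : 0 < (1 + x) ^ 2) by (apply pow_lt; lra).
assert (HF2 : ellipticF x = ratioH x * logG x) by (unfold ratioH; field; lra).
assert (1 <= (1 + x) ^ 2 * ratioH x).
{ apply Rmult_le_reg_r with (logG x); trivial.
  rewrite Rmult_assoc, <- HF2; lra. }
nra.
Qed.

Lemma ratioH_onto (y : R) : PI / (2 * ln 5) < y < 1 ->
  exists x, 0 < x < 1 /\ ratioH x = y.
Proof.
intros Hy.
destruct (ratioH_gt y) as [a [Ha Hya]]; [lra|].
rewrite <- ratioH_1 in Hy.
(* The difference y - F/G is negative at a and positive at 1; the latter also rules out 1 as the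
   root. *)
destruct (Ranalysis5.IVT_interv (fun x => y - ratioH x) a 1)
  as [x [Hx Hxy]]; try lra.
- intros t Ht; apply derivable_continuous_pt, ex_derive_Reals_0.
  assert (Hd : ex_derive ratioH t)
    by (eexists; apply is_derive_ratioH; lra).
  auto_derive; exact Hd.
- exists x; split; [|lra].
  split; [lra|].
  destruct Hx as [_ [Hx| ->]]; lra.
Qed.

(** * Return from x = r' to the modulus r *)

Lemma comodulus_range (r : R) : 0 < r < 1 -> 0 < comodulus r < 1.
Proof.
intros Hr; unfold comodulus; split; [apply sqrt_lt_R0; nra|].
rewrite <- sqrt_1 at 2; apply sqrt_lt_1_alt; nra.
Qed.

Lemma comodulus_sqr (r : R) : 0 < r < 1 -> comodulus r ^ 2 = 1 - r ^ 2.
Proof. intros Hr; apply pow2_sqrt; nra. Qed.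

Lemma comodulus_comodulus (x : R) : 0 < x < 1 -> comodulus (comodulus x) = x.
Proof.
intros Hx; unfold comodulus at 1; rewrite comodulus_sqr by lra.
replace (1 - (1 - x ^ 2)) with (x ^ 2) by ring; apply sqrt_pow2; lra.
Qed.

Lemma ellipticK_comodulus (r : R) : 0 < r < 1 ->
  ellipticK r = ellipticF (comodulus r).
Proof.
intros Hr; apply RInt_ext; intros t _.
unfold legDelta; rewrite comodulus_sqr by trivial.
unfold Rdiv; rewrite Rmult_1_l; do 2 f_equal.
pose proof (sin2_cos2_pow t); lra.
Qed.

Lemma Q2_comodulus (r : R) : 0 < r < 1 -> Q2 r = ratioH (comodulus r).
Proof. intros Hr; unfold Q2; now rewrite ellipticK_comodulus. Qed.

Lemma ellipticK_Q2 (r : R) : 0 < r < 1 ->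
  ellipticK r = Q2 r * ln (1 + 4 / comodulus r).
Proof.
intros Hr; pose proof (comodulus_range r Hr).
pose proof (logG_pos (comodulus r) ltac:(lra)) as HG; unfold logG in HG.
unfold Q2; field; lra.
Qed.

Theorem theorem2 :
  (forall r s : R, 0 < r -> r < s -> s < 1 -> Q2 r < Q2 s) /\
  (forall y : R,
     (exists r : R, 0 < r < 1 /\ Q2 r = y) <-> PI / ln 25 < y < 1) /\
  (forall r : R, 0 < r < 1 ->
     PI / (2 * ln 5) * ln (1 + 4 / comodulus r) < ellipticK r /\
     ellipticK r < ln (1 + 4 / comodulus r)) /\
  PI / ln 25 = PI / (2 * ln 5) /\
  (forall c : R,
     (forall r : R, 0 < r < 1 ->
        c * ln (1 + 4 / comodulus r) < ellipticK r) ->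
     c <= PI / (2 * ln 5)) /\
  (forall c : R,
     (forall r : R, 0 < r < 1 ->
        ellipticK r < c * ln (1 + 4 / comodulus r)) ->
     1 <= c).
Proof.
assert (H25 : ln 25 = 2 * ln 5).
{ replace 25 with (5 * 5) by lra; rewrite ln_mult by lra; lra. }
rewrite H25.
assert (Hrange : forall r, 0 < r < 1 -> PI / (2 * ln 5) < Q2 r < 1).
{ intros r Hr; pose proof (comodulus_range r Hr) as Hx.
  rewrite Q2_comodulus by trivial; split.
  - rewrite <- ratioH_1; apply ratioH_decr; lra.
  - now apply ratioH_lt_1. }
assert (Hpos : forall r, 0 < r < 1 -> 0 < ln (1 + 4 / comodulus r)).
{ intros r Hr; apply logG_pos, comodulus_range, Hr. }
assert (Honto : forall y, PI / (2 * ln 5) < y < 1 ->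
          exists r, 0 < r < 1 /\ Q2 r = y).
{ intros y Hy; destruct (ratioH_onto y Hy) as [x [Hx Hxy]].
  pose proof (comodulus_range x Hx).
  exists (comodulus x); split; trivial.
  now rewrite Q2_comodulus, comodulus_comodulus. }
assert (Hlt1 : PI / (2 * ln 5) < 1).
{ pose proof (Hrange (1 / 2) ltac:(lra)); lra. }
repeat split.
- intros r s Hr Hrs Hs.
  rewrite !Q2_comodulus by lra.
  (* Both r -> r' and F/G decrease, so their composition increases. *)
  apply ratioH_decr.
  + apply comodulus_range; lra.
  + apply sqrt_lt_1_alt; nra.
  + left; apply comodulus_range; lra.
- destruct H as [r [Hr <-]]; now apply Hrange.
- destruct H as [r [Hr <-]]; now apply Hrange.
- now apply Honto.
- rewrite (ellipticK_Q2 r H).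
  apply Rmult_lt_compat_r; [now apply Hpos|now apply Hrange].
- rewrite (ellipticK_Q2 r H).
  pose proof (Hpos r H); pose proof (Hrange r H); nra.
- intros c Hc; apply Rnot_lt_le; intros Hn.
  (* Capping c at 1 makes the midpoint q of PI / (2 ln 5) and b a value of [Q2]; at that r the
     hypothesis gives c < q, while q < b <= c. *)
  set (b := Rmin c 1).
  assert (Hb : PI / (2 * ln 5) < b) by now apply Rmin_glb_lt.
  assert (b <= c) by apply Rmin_l; assert (b <= 1) by apply Rmin_r.
  destruct (Honto ((PI / (2 * ln 5) + b) / 2)) as [r [Hr Hq]]; [lra|].
  specialize (Hc r Hr); rewrite (ellipticK_Q2 r Hr) in Hc.
  apply Rmult_lt_reg_r in Hc; [lra|now apply Hpos].
- intros c Hc; apply Rnot_lt_le; intros Hn.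
  (* Symmetrically, the midpoint q of b and 1 is attained, and the hypothesis gives q < c <= b <
     q. *)
  set (b := Rmax c (PI / (2 * ln 5))).
  assert (Hb : b < 1) by now apply Rmax_lub_lt.
  assert (c <= b) by apply Rmax_l.
  assert (PI / (2 * ln 5) <= b) by apply Rmax_r.
  destruct (Honto ((b + 1) / 2)) as [r [Hr Hq]]; [lra|].
  specialize (Hc r Hr); rewrite (ellipticK_Q2 r Hr) in Hc.
  apply Rmult_lt_reg_r in Hc; [lra|now apply Hpos].
Qed.
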